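(* There exists a simply connected geodesic metric space $\mathrm{E}$ such that $d_{\mathrm{GH}}(\mathrm{E},\mathbb{S}^1)=\frac{\pi}{4}$.
   Context: $\mathbb{S}^1=\{z\in\mathbb{R}^2 : \|z\|=1\}$ is equipped with its intrinsic (geodesic) metric $d_{\mathbb{S}^1}$, i.e. $d_{\mathbb{S}^1}(p,q)\in[0,\pi]$ is the angle between $p$ and $q$ seen as vectors of $\mathbb{R}^2$. For a metric space $(Z,d_Z)$ and nonempty $A,B\subseteq Z$, let $d_Z(z,A)=\inf_{a\in A}d_Z(z,a)$ and let the Hausdorff distance be $d_{\mathrm{H}}^Z(A,B)=\max\left(\sup_{a\in A}d_Z(a,B),\sup_{b\in B}d_Z(b,A)\right)$. The Gromov-Hausdorff distance between nonempty metric spaces $X,Y$ is the value in $[0,\infty]$ given by $d_{\mathrm{GH}}(X,Y)=\inf d_{\mathrm{H}}^Z(X',Y')$, the infimum being over all metric spaces $Z$ and subspaces $X',Y'\subseteq Z$ with $X'$ isometric to $X$ and $Y'$ isometric to $Y$. A metric space $(X,d_X)$ is a length space if for all $x,x'\in X$ the distance $d_X(x,x')$ is the infimum of the lengths of paths $\gamma:[0,1]\to X$ from $x$ to $x'$; it is geodesic if in addition for all $x,x'\in X$ there is a path from $x$ to $x'$ of length $d_X(x,x')$. *)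

(* Defs.v *)
From HB Require Import structures.
From mathcomp Require Import all_boot all_order all_algebra.
From mathcomp Require Import all_classical all_reals all_analysis.
From mathcomp Require Import ring lra.

Set Implicit Arguments.
Unset Strict Implicit.
Unset Printing Implicit Defensive.

Import Order.TTheory GRing.Theory Num.Theory.
Import numFieldNormedType.Exports.

Local Open Scope classical_set_scope.
Local Open Scope ring_scope.

Section gromov_hausdorff.
Context {R : realType}.

Definition dist_to_set {Z : metricType R} (z : Z) (A : set Z) : \bar R :=
  ereal_inf [set (mdist z a)%:E | a in A].

Definition hausdorff_dist {Z : metricType R} (A B : set Z) : \bar R :=
  maxe (ereal_sup [set dist_to_set a B | a in A])
       (ereal_sup [set dist_to_set b A | b in B]).

Definition isometric_to_subset (X Z : metricType R) (A : set Z) : Prop :=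
  exists f : X -> Z,
    set_bij [set: X] A f /\ forall x y, mdist (f x) (f y) = mdist x y.

Definition gromov_hausdorff_dist (X Y : metricType R) : \bar R :=
  ereal_inf [set d | exists (Z : metricType R) (X' Y' : set Z),
    [/\ isometric_to_subset X X', isometric_to_subset Y Y'
      & d = hausdorff_dist X' Y']].

End gromov_hausdorff.

(* A path is a function on R of which only the restriction to [0, 1] matters. *)
Section paths.
Context {R : realType} {X : metricType R}.

Definition is_path (x y : X) (g : R -> X) : Prop :=
  [/\ {within `[0, 1], continuous g}, g 0 = x & g 1 = y].

(* [itv_partition 0 1 s] says that 0 :: s is strictly increasing and ends at 1;
   compare [total_variation] for real-valued functions. *)
Definition path_length (g : R -> X) : \bar R :=
  ereal_sup [set (\sum_(0 <= i < size s)
                    mdist (g (nth 1 (0 :: s) i)) (g (nth 1 (0 :: s) i.+1)))%:E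
            | s in itv_partition 0 1].

Definition path_homotopic (g h : R -> X) : Prop :=
  exists H : R * R -> X,
    [/\ {within `[0, 1] `*` `[0, 1], continuous H},
        forall t, t \in `[0, 1] -> H (t, 0) = g t /\ H (t, 1) = h t
      & forall s, s \in `[0, 1] -> H (0, s) = g 0 /\ H (1, s) = g 1].

End paths.

Section spaces.
Context {R : realType}.

Definition length_space (X : metricType R) : Prop :=
  forall x y : X,
    (mdist x y)%:E = ereal_inf [set path_length g | g in is_path x y].

Definition geodesic_space (X : metricType R) : Prop :=
  length_space X /\
  forall x y : X, exists2 g, is_path x y g & path_length g = (mdist x y)%:E.

Definition path_connected_space (X : metricType R) : Prop :=
  [set: X] !=set0 /\ forall x y : X, exists g, is_path x y g.

Definition simply_connected (X : metricType R) : Prop :=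
  path_connected_space X /\
  forall (x : X) (g : R -> X), is_path x x g -> path_homotopic g (cst x).

End spaces.

Section circle.
Context (R : realType).
Implicit Types u v w : R * R.

Definition dotp u v : R := u.1 * v.1 + u.2 * v.2.

(* The library's norm on R * R is the sup norm, hence this definition. *)
Definition euclidean_norm u : R := Num.sqrt (dotp u u).

Definition circle : Type := {u : R * R | euclidean_norm u == 1}.

HB.instance Definition _ := Choice.copy circle {u : R * R | euclidean_norm u == 1}.

(* The angle between two unit vectors. *)
Definition circle_dist (p q : circle) : R := acos (dotp (val p) (val q)).

Let dotpp (p : circle) : dotp (val p) (val p) = 1.
Proof.
have /eqP e := valP p; rewrite -[RHS](expr1n _ 2) -[X in X ^+ 2]e sqr_sqrtr//.
by rewrite addr_ge0// -expr2 sqr_ge0.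
Qed.

Let crossp u v : R := u.1 * v.2 - u.2 * v.1.

Let crosspE (p q : circle) :
  crossp (val p) (val q) ^+ 2 = 1 - dotp (val p) (val q) ^+ 2.
Proof.
have := dotpp p; have := dotpp q.
case: p => -[a b] /= _; case: q => -[c d] /= _; rewrite /dotp /crossp /=.
move=> h1 h2; have -> : 1 = (a * a + b * b) * (c * c + d * d) :> R.
  by rewrite h1 h2 mulr1.
ring.
Qed.

Let dotp_itv (p q : circle) : -1 <= dotp (val p) (val q) <= 1.
Proof.
by rewrite -ler_norml -(@ler_sqr _ `|_|) ?nnegrE// real_normK ?num_real//
  expr1n -subr_ge0 -crosspE sqr_ge0.
Qed.

Let circle_distxx p : circle_dist p p = 0.
Proof. by rewrite /circle_dist dotpp acos1. Qed.

Let circle_dist_eq0 p q : circle_dist p q = 0 -> p = q.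
Proof.
move=> pq0; have pq1 : dotp (val p) (val q) = 1.
  by rewrite -[LHS](@acosK R) ?in_itv//= ?dotp_itv// [acos _]pq0 cos0.
apply: val_inj; have := dotpp p; have := dotpp q; move: pq1.
case: (val p) (val q) => [a b] [c d]; rewrite /dotp /= => h1 h2 h3.
have : (a - c) ^+ 2 + (b - d) ^+ 2 == 0 by apply/eqP; lra.
rewrite paddr_eq0 ?sqr_ge0// !sqrf_eq0 !subr_eq0.
by move=> /andP[/eqP -> /eqP ->].
Qed.

Let circle_distC p q : circle_dist p q = circle_dist q p.
Proof. by rewrite /circle_dist /dotp mulrC [X in _ + X]mulrC. Qed.

Let circle_dist_triangle q p r :
  circle_dist p r <= circle_dist p q + circle_dist q r.
Proof.
have [apq _] := acos_def (dotp_itv p q); have [aqr _] := acos_def (dotp_itv q r).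
have [apr _] := acos_def (dotp_itv p r); rewrite /circle_dist.
case: (lerP (acos (dotp (val p) (val q)) + acos (dotp (val q) (val r))) pi);
  last by lra.
move=> lepi.
have le_cos : cos (acos (dotp (val p) (val q)) + acos (dotp (val q) (val r)))
    <= cos (acos (dotp (val p) (val r))).
  rewrite cosD !acosK ?in_itv ?[_ && _]dotp_itv// !sin_acos ?dotp_itv//.
  rewrite -!crosspE !sqrtr_sqr.
  have -> : dotp (val p) (val r) = dotp (val p) (val q) * dotp (val q) (val r)
                                 - crossp (val p) (val q) * crossp (val q) (val r).
    by rewrite -[LHS]mulr1 -[X in _ * X](dotpp q) /dotp /crossp; ring.
  by rewrite lerD2l lerN2 -normrM ler_norm.
rewrite leNgt; apply/negP; rewrite -ltr_cos ?in_itv/=; lra.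
Qed.

HB.instance Definition _ := @isMetric.Build R circle circle_dist
  circle_distxx circle_dist_eq0 circle_distC circle_dist_triangle.

End circle.

(* Main.v *)
Require Import Defs.
From HB Require Import structures.
From mathcomp Require Import all_boot all_order all_algebra.
From mathcomp Require Import all_classical all_reals all_analysis.
From mathcomp Require Import ring lra zify.

Set Implicit Arguments.
Unset Strict Implicit.
Unset Printing Implicit Defensive.

Import Order.TTheory GRing.Theory Num.Theory.
Import numFieldNormedType.Exports.

Local Open Scope classical_set_scope.
Local Open Scope ring_scope.

(** The space is the triangle |x| <= y <= pi/2 of the plane with the sup metric.
It is convex, hence simply connected and geodesic; only the distance to the
circle needs an argument.

Upper bound.  A correspondence of distortion at most pi/2 between two metric
spaces glues them into one space where they are at Hausdorff distance at most
pi/4 ([gromov_hausdorff_le_corr]).  Points of the left half of the triangle are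
matched with the angle x - pi/4, those of the right half with x + pi/4, so that
the angle jumps by pi/2 across the axis x = 0.  The two ends of the top side
carry a second angle, in which the top side is folded towards the angle pi, and
the apex is matched with the whole arc [-pi/4, pi/4] that the jump leaves out.
Going along the top side therefore turns once around the circle except for the
jump over that arc, and the apex is at distance pi/2 from the whole top side,
as far as the angles pi on that side require.

Lower bound.  Suppose that a space with a conical bicombing is matched with the
circle with distortion less than D < pi/2.  Label every point by a matched
angle.  Labels of close points differ by less than pi/2 on the circle, so the
four increments around a small quadrilateral add up to less than 2 pi, hence to
0: the labels lift, up to multiples of 2 pi, to a function whose increments
between close points are the increments of the labels on the circle
([angle_lift]).  Now follow points matched with an angle t that increases from
0 to 2 pi by small steps.  Between two successive ones the geodesic has length
less than about D, so every point on it is within D/2 of one of its ends, and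
its label is within about 3D/2 of t.  A step of length D cannot cross the
antipode of t, because 3D/2 + 3D/2 + D = 4D < 2 pi; thus the lift increases
along the geodesic as t does.  After a full turn it has increased by 2 pi while
the point has come back: a contradiction
([correspondence_circle_distortion]).  The constant pi/2 comes from 4D = 2 pi,
and the triangle is built so that equality holds. *)

(** * Angles modulo 2 pi and points of the circle *)

Section angles.
Context {R : realType}.
Implicit Types (s t : R) (k : int).

(** The representative of the angle [t] modulo 2 pi in [-pi, pi). *)
Definition wrap t : R := t - (Num.floor (t / (2 * pi) + 2^-1))%:~R * (2 * pi).

Lemma wrap_congr t : exists k, wrap t = t + k%:~R * (2 * pi).
Proof.
by exists (- Num.floor (t / (2 * pi) + 2^-1)); rewrite intrN mulNr.
Qed.

Lemma wrap_itv t : - pi <= wrap t < pi.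
Proof.
have pi0 := pi_gt0 R; set x := t / (2 * pi) + 2^-1.
have tE : t = (x - 2^-1) * (2 * pi).
  by rewrite /x addrK divfK// mulf_neq0// gt_eqF.
have := floor_itv x; rewrite intrD /wrap -/x [in X in _ -> X]tE.
set n := (Num.floor x)%:~R; move=> /andP[h1 h2].
by apply/andP; split; nra.
Qed.

Lemma normr_wrap t : `|wrap t| <= pi.
Proof. by have /andP[? ?] := wrap_itv t; rewrite ler_norml; lra. Qed.

(** Every winding argument below ends with this remark: a sum of whole turns that
is shorter than one turn vanishes. *)
Lemma eq_congr_lt k s t : s = t + k%:~R * (2 * pi) -> `|s - t| < 2 * pi -> s = t.
Proof.
have pi0 := pi_gt0 R.
move=> -> ; rewrite [X in `|X|]addrC addKr normrM [`|2 * pi|]gtr0_norm; last by lra.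
rewrite gtr_pMl; last by lra.
rewrite -intr_norm -[X in _ < X]/(1%:~R) ltr_int => k1.
have -> : k = 0 by lia.
by rewrite mul0r addr0.
Qed.

Lemma wrap_unique k s t :
  s = t + k%:~R * (2 * pi) -> `|s - wrap t| < 2 * pi -> s = wrap t.
Proof.
have [l ->] := wrap_congr t => ->; apply: (@eq_congr_lt (k - l)).
by rewrite intrB; ring.
Qed.

Lemma wrap0 : wrap 0 = 0.
Proof.
apply/esym/(@wrap_unique 0); first by rewrite mul0r addr0.
by have := wrap_itv 0; rewrite ltr_norml => /andP[]; have := pi_gt0 R; lra.
Qed.

Lemma wrapB2pi t : wrap (t - 2 * pi) = wrap t.
Proof.
have [k e] := wrap_congr (t - 2 * pi).
apply: (@wrap_unique (k - 1)); first by rewrite e intrB; ring.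
have := wrap_itv t; have := wrap_itv (t - 2 * pi).
by rewrite ltr_norml => /andP[? ?] /andP[? ?]; lra.
Qed.

Lemma normr_wrap_le k t : `|wrap t| <= `|t + k%:~R * (2 * pi)|.
Proof.
have pi0 := pi_gt0 R.
have /andP[h1 h2] := wrap_itv t.
have [lt|] := ltP `|t + k%:~R * (2 * pi)| pi; last first.
  by apply: le_trans; rewrite ler_norml; lra.
rewrite -(@wrap_unique k (t + k%:~R * (2 * pi)) t)//.
by move: lt; rewrite !ltr_norml => /andP[? ?]; lra.
Qed.

Lemma wrap_cases t : `|t| < 3 * pi ->
  [\/ wrap t = t, wrap t = t - 2 * pi | wrap t = t + 2 * pi].
Proof.
have pi0 := pi_gt0 R; have [k kE] := wrap_congr t; have := wrap_itv t.
rewrite {1 2}kE ltr_norml => /andP[h1 h2] /andP[h3 h4].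
have k2 : k%:~R < 2 :> R by rewrite -(ltr_pM2r pi0); lra.
have k1 : - 2 < k%:~R :> R by rewrite -(ltr_pM2r pi0); lra.
move: k1 k2; rewrite -[X in - X < _]/((2 : int)%:~R) -intrN ltr_int => k1.
rewrite -[X in _ < X]/((2 : int)%:~R) ltr_int => k2.
have [kk|[kk|kk]] : k = 0 \/ k = -1 \/ k = 1 by lia.
- by constructor 1; rewrite kE kk mul0r addr0.
- by constructor 2; rewrite kE kk intrN mulN1r.
- by constructor 3; rewrite kE kk mul1r.
Qed.

Lemma cosD2piz k t : cos (t + k%:~R * (2 * pi)) = cos t.
Proof.
have H (n : nat) u : cos (u + n%:R * (2 * pi)) = cos u :> R.
  by rewrite [n%:R * _]mulr_natl; apply: periodicn => v; rewrite [2 * _]mulr_natl cosD2pi.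
case: k => n; first by rewrite -pmulrn H.
by rewrite NegzE intrN mulNr -[in RHS](subrK (n.+1%:~R * (2 * pi)) t) -pmulrn H.
Qed.

Lemma acos_cos t : acos (cos t) = `|wrap t|.
Proof.
have [k e] := wrap_congr t; have /andP[h1 h2] := wrap_itv t.
rewrite -(cosD2piz k) -e; have [w0|w0] := lerP 0 (wrap t).
  by rewrite cosK ?ger0_norm// in_itv/= w0 ltW.
by rewrite cosKN ?ltr0_norm// h1 ltW.
Qed.

Lemma euclidean_norm_cos_sin t : euclidean_norm (cos t, sin t) == 1.
Proof. by rewrite /euclidean_norm /dotp/= -!expr2 cos2Dsin2 sqrtr1. Qed.

Definition circle_pt t : circle R :=
  exist (fun u => euclidean_norm u == 1) (cos t, sin t) (euclidean_norm_cos_sin t).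

Lemma mdist_circle_pt s t : mdist (circle_pt s) (circle_pt t) = `|wrap (s - t)|.
Proof. by rewrite -acos_cos cosB. Qed.

Lemma circle_ptB2pi t : circle_pt (t - 2 * pi) = circle_pt t.
Proof.
apply: mdist_positivity; rewrite mdist_circle_pt.
by rewrite addrAC subrr wrapB2pi wrap0 normr0.
Qed.

Lemma circle_pt_surj (p : circle R) : exists2 t, - pi <= t <= pi & p = circle_pt t.
Proof.
have pi0 := pi_gt0 R.
case: p => -[a b] ab1; have := eqP ab1; rewrite /euclidean_norm /dotp/= => /(congr1 (fun x => x ^+ 2)).
rewrite sqr_sqrtr ?addr_ge0 -?expr2 ?sqr_ge0// expr1n => ab.
have a1 : -1 <= a <= 1.
  by rewrite -ler_norml -(@ler_sqr _ `|_|) ?nnegrE// real_normK ?num_real// expr1n -ab lerDl sqr_ge0.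
have sb : Num.sqrt (1 - a ^+ 2) = `|b|.
  by rewrite -ab addrC addKr sqrtr_sqr.
have [b0|b0] := lerP 0 b.
  exists (acos a); first by rewrite acos_lepi// andbT (le_trans _ (acos_ge0 a1))//; lra.
  apply: val_inj => /=; rewrite acosK ?in_itv//= sin_acos// sb ger0_norm//.
exists (- acos a); first by have := acos_lepi a1; have := acos_ge0 a1; lra.
by apply: val_inj => /=; rewrite cosN sinN acosK ?in_itv//= sin_acos// sb ltr0_norm// opprK.
Qed.

End angles.

(** * Conical bicombings *)

Section bicombing.
Context {R : realType} {X : metricType R}.
Implicit Types (x y z : X) (s t : R).

(** A choice of constant-speed geodesics that spread no faster than their end
points when they start from a common point, as straight segments of a convex
set do. *)
Definition conical_bicombing (sigma : X -> X -> R -> X) : Prop :=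
  [/\ forall x y, sigma x y 0 = x /\ sigma x y 1 = y,
      forall x y s t, s \in `[0, 1] -> t \in `[0, 1] ->
        mdist (sigma x y s) (sigma x y t) = `|s - t| * mdist x y
    & forall x y z t, t \in `[0, 1] ->
        mdist (sigma x y t) (sigma x z t) <= mdist y z].

Lemma mdist_le_path_length x y g : is_path x y g -> ((mdist x y)%:E <= path_length g)%E.
Proof.
move=> [_ g0 g1]; apply: le_ereal_sup_tmp; exists (mdist x y)%:E => //.
exists [:: 1]; first exact: itv_partition1.
by rewrite /= big_nat1/= g0 g1.
Qed.

Context (sigma : X -> X -> R -> X).
Hypothesis sigmaP : conical_bicombing sigma.

Lemma bicombing_is_path x y : is_path x y (sigma x y).
Proof.
have [ends len _] := sigmaP; have [s0 s1] := ends x y.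
split=> //; apply/subspace_continuousP => t t01.
apply/metricType_numDomainType.cvgrPdist_lt => e e0 /=.
have d0 : 0 < mdist x y + 1 by rewrite ltr_wpDl ?mdist_ge0.
have ed : 0 < e / (mdist x y + 1) by rewrite divr_gt0.
have /cvgrPdist_lt/(_ _ ed) := @cvg_id _ (nbhs t).
rewrite near_withinE; apply: filterS => u + u01; rewrite len//.
rewrite ltr_pdivlMr//; apply: le_lt_trans.
by rewrite ler_wpM2l// lerDl.
Qed.

(** Along a constant-speed geodesic the sum over a partition telescopes. *)
Lemma path_length_bicombing x y : path_length (sigma x y) = (mdist x y)%:E.
Proof.
apply/eqP; rewrite eq_le mdist_le_path_length ?andbT; last exact: bicombing_is_path.
have [_ len _] := sigmaP.
apply: ge_ereal_sup => _ [s sP <-]; rewrite lee_fin.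
have in01 i : (i < (size s).+1)%N -> nth 1 (0 :: s) i \in `[(0 : R), 1].
  by move=> si; rewrite in_itv/= (itv_partition_nth_ge si sP) (itv_partition_nth_le si sP).
rewrite (@eq_big_nat _ _ _ _ _ _
  (fun i => (nth 1 (0 :: s) i.+1 - nth 1 (0 :: s) i) * mdist x y)); last first.
  move=> i /andP[_ si]; rewrite len; [|exact/in01/ltnW|exact: in01].
  rewrite distrC ger0_norm// subr_ge0.
  case: sP => /pathP ps _; exact/ltW/ps.
rewrite -big_distrl/= telescope_sumr// (itv_partition_nth_size 1 sP).
by rewrite subr0 mul1r.
Qed.

Lemma bicombing_geodesic : geodesic_space X.
Proof.
split=> x y; last first.
  by exists (sigma x y); [exact: bicombing_is_path|exact: path_length_bicombing].
apply/eqP; rewrite eq_le; apply/andP; split.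
  by apply: le_ereal_inf_tmp => _ [g gP <-]; exact: mdist_le_path_length.
rewrite -path_length_bicombing; apply: ereal_inf_lbound.
by exists (sigma x y) => //; exact: bicombing_is_path.
Qed.

(** A loop is contracted to its base point along the chosen geodesics. *)
Lemma bicombing_simply_connected : [set: X] !=set0 -> simply_connected X.
Proof.
move=> X0; have [ends len conical] := sigmaP.
split; first by split=> // x y; exists (sigma x y); exact: bicombing_is_path.
move=> x g [gc g0 g1].
have sxx t : t \in `[0, 1] -> sigma x x t = x.
  move=> t01; apply: mdist_positivity; rewrite -[X in mdist _ X](ends x x).1.
  by rewrite len ?mdistxx ?mulr0// in_itv/= lexx ler01.
have onem01 t : t \in `[0, 1] -> 1 - t \in `[0, 1].
  by rewrite !in_itv/= => /andP[? ?]; lra.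
exists (fun p => sigma x (g p.1) (1 - p.2)); split=> /=.
- apply/subspace_continuousP => -[t s] [/= t01 s01].
  apply/metricType_numDomainType.cvgrPdist_lt => e e0 /=.
  have d0 : 0 < mdist x (g t) + 1 by rewrite ltr_wpDl ?mdist_ge0.
  have ed : 0 < e / 2 / (mdist x (g t) + 1) by rewrite divr_gt0// divr_gt0.
  have e20 : 0 < e / 2 by rewrite divr_gt0.
  move/subspace_continuousP : gc => /(_ t t01).
  move=> /metricType_numDomainType.cvgrPdist_lt/(_ _ e20) gt.
  have st : \forall u \near s, `|s - u| < e / 2 / (mdist x (g t) + 1).
    by have /cvgrPdist_lt/(_ _ ed) := @cvg_id _ (nbhs s).
  exists ([set t' | t' \in `[0, 1] -> mdist (g t) (g t') < e / 2],
          [set s' | `|s - s'| < e / 2 / (mdist x (g t) + 1)]) => /=.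
    by split; [exact: gt|exact: st].
  move=> [t' s']/= [gt' st'] [t'01 s'01].
  rewrite (le_lt_trans (metric_triangle _ (sigma x (g t) (1 - s')) _))//.
  rewrite [ltRHS]splitr addrC ltr_leD//.
    by rewrite (le_lt_trans (conical _ _ _ _ (onem01 _ s'01)))// gt'.
  rewrite len ?onem01//.
  have -> : 1 - s - (1 - s') = s' - s by ring.
  rewrite distrC; move/ltW: st'; rewrite ler_pdivlMr//; apply: le_trans.
  by rewrite ler_wpM2l// lerDl.
- move=> t t01; rewrite subr0 subrr; split; first exact: (ends _ _).2.
  exact: (ends _ _).1.
- by move=> s s01; rewrite g0 g1 sxx ?onem01.
Qed.

End bicombing.

(** * Gromov-Hausdorff distance and correspondences *)

Section correspondences.
Context {R : realType}.

Definition correspondence (X Y : Type) (C : X -> Y -> Prop) : Prop :=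
  (forall x, exists y, C x y) /\ (forall y, exists x, C x y).

(** Points of the two copies at distance less than [r] in the common space are
matched; the triangle inequality bounds the distortion. *)
Lemma gromov_hausdorff_lt_corr (X Y : metricType R) (r : R) :
  (gromov_hausdorff_dist X Y < r%:E)%E ->
  exists2 C : X -> Y -> Prop, correspondence C &
    forall x x' y y', C x y -> C x' y' -> `|mdist x x' - mdist y y'| < 2 * r.
Proof.
move=> /ereal_inf_lt[_ [Z [A [B [[f [fA fd]] [g [gB gd]] ->]]]]].
rewrite /hausdorff_dist gt_max => /andP[AB BA].
exists (fun x y => mdist (f x) (g y) < r); first split.
- move=> x; have : (dist_to_set (f x) B < r%:E)%E.
    apply: le_lt_trans AB; apply: ereal_sup_ubound.
    by exists (f x) => //; case: fA => + _ _; apply.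
  move=> /ereal_inf_lt[_ [b Bb <-]]; rewrite lte_fin => xb.
  by have [_ _ /(_ _ Bb)[y _ yb]] := gB; exists y; rewrite yb.
- move=> y; have : (dist_to_set (g y) A < r%:E)%E.
    apply: le_lt_trans BA; apply: ereal_sup_ubound.
    by exists (g y) => //; case: gB => + _ _; apply.
  move=> /ereal_inf_lt[_ [a Aa <-]]; rewrite lte_fin => ya.
  by have [_ _ /(_ _ Aa)[x _ xa]] := fA; exists x; rewrite xa metric_sym.
- move=> x x' y y' xy x'y'; rewrite -fd -gd ltr_norml.
  have h1 := metric_triangle (f x) (g y) (f x').
  have h2 := metric_triangle (g y) (g y') (f x').
  have h3 := metric_triangle (g y) (f x) (g y').
  have h4 := metric_triangle (f x) (f x') (g y').
  rewrite (metric_sym (g y') (f x')) in h2; rewrite (metric_sym (g y) (f x)) in h3.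
  by apply/andP; split; lra.
Qed.

Section glue.
Variables (X Y : metricType R) (C : X -> Y -> Prop) (r : R).
Hypotheses (r0 : 0 < r) (corrC : correspondence C).
Hypothesis distC : forall x x' y y', C x y -> C x' y' ->
  `|mdist x x' - mdist y y'| <= 2 * r.

Definition detours x y : set R :=
  [set d | exists x' y', C x' y' /\ d = mdist x x' + r + mdist y' y].

(** On the disjoint union, matched points are put at distance [r] and all other
mixed distances are the shortest detours through a matched pair.  The bound on
the distortion is what keeps detours from shortening distances inside either
space. *)
Definition bridge x y : R := inf (detours x y).

Lemma bridge_le x y x' y' : C x' y' -> bridge x y <= mdist x x' + r + mdist y' y.
Proof.
move=> Cxy; apply: ge_inf; last by exists x', y'.
by exists 0 => _ [? [? [_ ->]]]; rewrite !addr_ge0// ?mdist_ge0// ltW.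
Qed.

Lemma le_bridge x y d :
  (forall x' y', C x' y' -> d <= mdist x x' + r + mdist y' y) -> d <= bridge x y.
Proof.
move=> dP; apply: lb_le_inf; last by move=> _ [? [? [? ->]]]; exact: dP.
by have [y' Cxy'] := corrC.1 x; exists (mdist x x + r + mdist y' y), x, y'.
Qed.

Definition glue_dist (u v : X + Y) : R :=
  match u, v with
  | inl x, inl x' => mdist x x'
  | inr y, inr y' => mdist y y'
  | inl x, inr y | inr y, inl x => bridge x y
  end.

Lemma bridge_ge x y : r <= bridge x y.
Proof.
by apply: le_bridge => x' y' _; have := mdist_ge0 x x'; have := mdist_ge0 y' y; lra.
Qed.

Lemma glue_distxx u : glue_dist u u = 0.
Proof. by case: u => a /=; rewrite mdistxx. Qed.

Lemma glue_dist_eq0 u v : glue_dist u v = 0 -> u = v.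
Proof.
case: u v => [x|y] [x'|y'] /=.
- by move=> /mdist_positivity ->.
- by move=> h; have := bridge_ge x y'; rewrite h leNgt r0.
- by move=> h; have := bridge_ge x' y; rewrite h leNgt r0.
- by move=> /mdist_positivity ->.
Qed.

Lemma glue_distC u v : glue_dist u v = glue_dist v u.
Proof. by case: u v => [x|y] [x'|y'] //=; rewrite metric_sym. Qed.

Lemma bridge_trianglel x x' y : bridge x y <= mdist x x' + bridge x' y.
Proof.
rewrite -lerBlDl; apply: le_bridge => a b Cab.
by have := bridge_le x y Cab; have := metric_triangle x x' a; lra.
Qed.

Lemma bridge_triangler x y y' : bridge x y <= bridge x y' + mdist y' y.
Proof.
rewrite -lerBlDr; apply: le_bridge => a b Cab.
by have := bridge_le x y Cab; have := metric_triangle b y' y; lra.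
Qed.

Lemma mdist_le_bridgel x x' y : mdist x x' <= bridge x y + bridge x' y.
Proof.
rewrite -lerBlDr; apply: le_bridge => a b Cab.
rewrite lerBlDr -lerBlDl; apply: le_bridge => a' b' Cab'.
have := distC Cab Cab'; rewrite ler_norml => /andP[_ h].
have := metric_triangle x a x'; have := metric_triangle a a' x'.
have := metric_triangle b y b'; rewrite (metric_sym a' x') (metric_sym y b'); lra.
Qed.

Lemma mdist_le_bridger x y y' : mdist y y' <= bridge x y + bridge x y'.
Proof.
rewrite -lerBlDr; apply: le_bridge => a b Cab.
rewrite lerBlDr -lerBlDl; apply: le_bridge => a' b' Cab'.
have := distC Cab Cab'; rewrite ler_norml => /andP[h _].
have := metric_triangle y b y'; have := metric_triangle b b' y'.
have := metric_triangle a x a'; rewrite (metric_sym y b) (metric_sym a x); lra.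
Qed.

Lemma glue_dist_triangle v u w : glue_dist u w <= glue_dist u v + glue_dist v w.
Proof.
case: u v w => [x|y] [x'|y'] [x''|y''] /=.
- exact: metric_triangle.
- exact: bridge_trianglel.
- exact: mdist_le_bridgel.
- exact: bridge_triangler.
- by rewrite addrC metric_sym; exact: bridge_trianglel.
- exact: mdist_le_bridger.
- by rewrite addrC metric_sym; exact: bridge_triangler.
- exact: metric_triangle.
Qed.

Lemma gromov_hausdorff_le_corr : (gromov_hausdorff_dist X Y <= r%:E)%E.
Proof.
pose mix := isMetric.Build R (X + Y)%type
  glue_distxx glue_dist_eq0 glue_distC glue_dist_triangle.
pose Z : metricType R := HB.pack (X + Y)%type mix.
apply: ge_ereal_inf.
exists (@hausdorff_dist R Z (range (inl : X -> Z)) (range (inr : Y -> Z))).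
  exists Z, (range inl), (range inr); split=> //.
  - exists inl; split=> //; split;
      [by move=> a _; exists a|by move=> ? ? _ _ []|by []].
  - exists inr; split=> //; split;
      [by move=> a _; exists a|by move=> ? ? _ _ []|by []].
rewrite /hausdorff_dist ge_max; apply/andP; split.
- apply: ge_ereal_sup => _ [_ [x _ <-] <-]; apply: ge_ereal_inf.
  have [y Cxy] := corrC.1 x.
  exists (bridge x y)%:E; first by exists (inr y) => //; exists y.
  by rewrite lee_fin (le_trans (bridge_le x y Cxy))// !mdistxx add0r addr0.
- apply: ge_ereal_sup => _ [_ [y _ <-] <-]; apply: ge_ereal_inf.
  have [x Cxy] := corrC.2 y.
  exists (bridge x y)%:E; first by exists (inl x) => //; exists x.
  by rewrite lee_fin (le_trans (bridge_le x y Cxy))// !mdistxx add0r addr0.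
Qed.

End glue.
End correspondences.

(** * Lower bound for spaces with a conical bicombing *)

Section lower_bound.
Context {R : realType} {X : metricType R}.
Context (sigma : X -> X -> R -> X).
Hypothesis sigmaP : conical_bicombing sigma.

Lemma locally_constant (f : R -> R) (rho : R) : 0 < rho ->
  (forall s t, s \in `[0, 1] -> t \in `[0, 1] -> `|s - t| < rho -> f s = f t) ->
  f 0 = f 1.
Proof.
move=> rho0 fP; pose n := Num.truncn rho^-1.
have n0 : 0 < n.+1%:R :> R by rewrite ltr0n.
have nP : n.+1%:R^-1 < rho.
  rewrite -[ltRHS]invrK ltf_pV2 ?posrE ?invr_gt0//; exact: truncnS_gt.
have grid j : (j <= n.+1)%N -> j%:R / n.+1%:R \in `[(0 : R), 1].
  by move=> jn; rewrite in_itv/= divr_ge0//= ler_pdivrMr// mul1r ler_nat.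
have step j : (j <= n.+1)%N -> f 0 = f (j%:R / n.+1%:R).
  elim: j => [_|j ih jn]; first by rewrite mul0r.
  rewrite ih ?(ltnW jn)//; apply: fP; [exact/grid/ltnW|exact: grid|].
  rewrite distrC -mulrBl -natr1 addrAC subrr add0r mul1r.
  by rewrite gtr0_norm// invr_gt0.
by rewrite (step n.+1 (leqnn _)) divff// gt_eqF.
Qed.

(** The lift at [x] adds up the increments of [phi] along a fine subdivision of the
chosen geodesic from [o] to [x].  The subdivided geodesics to two close points
form a ladder of small quadrilaterals.  Around each of them the increments of
[phi] add up to a multiple of 2 pi smaller than 2 pi, that is, to 0, so the
difference of the partial sums is the increment along the rung. *)
Lemma angle_lift (o : X) (phi : X -> R) (delta M : R) : 0 < delta ->
  (forall x y : X, mdist x y <= M) ->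
  (forall x y : X, mdist x y < delta -> `|wrap (phi y - phi x)| < pi / 2) ->
  exists Phi : X -> R, forall x y : X, mdist x y < delta ->
    Phi y - Phi x = wrap (phi y - phi x).
Proof.
move=> delta0 bndX jump; have [ends len conical] := sigmaP.
have M0 : 0 <= M by apply: le_trans (bndX o o); exact: mdist_ge0.
pose N := (Num.truncn (M / delta)).+1.
have N0 : 0 < N%:R :> R by rewrite ltr0n.
have NM : M / N%:R < delta.
  by rewrite ltr_pdivrMr// [ltRHS]mulrC -ltr_pdivrMr//; exact: truncnS_gt.
pose p j x := sigma o x (j%:R / N%:R).
have grid j : (j <= N)%N -> j%:R / N%:R \in `[(0 : R), 1].
  by move=> jn; rewrite in_itv/= divr_ge0//= ler_pdivrMr// mul1r ler_nat.
have radial j x : (j < N)%N -> mdist (p j x) (p j.+1 x) < delta.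
  move=> jN; rewrite len; [|exact/grid/ltnW|exact: grid].
  rewrite -mulrBl -natr1 opprD addNKr normrM normrN1 mul1r gtr0_norm ?invr_gt0//.
  rewrite mulrC; apply: le_lt_trans NM.
  by rewrite ler_pM2r ?invr_gt0.
pose S j x := \sum_(0 <= i < j) wrap (phi (p i.+1 x) - phi (p i x)).
exists (S N) => x y xy.
have claim j : (j <= N)%N -> S j y - S j x = wrap (phi (p j y) - phi (p j x)).
  elim: j => [_|j ih jN].
    by rewrite /S !big_nil /p mul0r !(ends _ _).1 !subrr wrap0.
  rewrite /S !big_nat_recr//= -/(S _ _) -/(S _ _) opprD addrACA ih ?(ltnW jN)//.
  have lat i : (i <= N)%N -> `|wrap (phi (p i y) - phi (p i x))| < pi / 2.
    by move=> iN; apply/jump/(le_lt_trans _ xy)/conical/grid.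
  move: (jump _ _ (radial j x jN)) (jump _ _ (radial j y jN)).
  move: (lat _ jN) (lat _ (ltnW jN)).
  have [a ->] := wrap_congr (phi (p j y) - phi (p j x)).
  have [b ->] := wrap_congr (phi (p j.+1 y) - phi (p j y)).
  have [c ->] := wrap_congr (phi (p j.+1 x) - phi (p j x)).
  move=> h1 h2 h3 h4; apply: (@wrap_unique _ (a + b - c)).
    by rewrite intrB intrD; ring.
  by move: h1 h2 h3 h4; rewrite !ltr_norml => /andP[? ?] /andP[? ?] /andP[? ?] /andP[? ?]; lra.
by rewrite claim// /p divff ?gt_eqF// !(ends _ _).2.
Qed.

(** If the distortion were less than [D < pi / 2], the quantity [a t], the value of
the lift corrected by the angle from [t] to the label of the point matched with
[t], would increase by [eta] when [t] does, and yet be 2 pi-periodic. *)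
Theorem correspondence_circle_distortion (C : X -> circle R -> Prop) (D : R) :
  correspondence C ->
  (forall x x' p p', C x p -> C x' p' -> `|mdist x x' - mdist p p'| < D) ->
  pi / 2 <= D.
Proof.
move=> [CX CS] distC; rewrite leNgt; apply/negP => Dlt.
have [ends len conical] := sigmaP; have pi0 := pi_gt0 R.
have [phi phiP] : exists phi : X -> R, forall x, C x (circle_pt (phi x)).
  have /choice[phi phiP] : forall x, exists t, C x (circle_pt t).
    by move=> x; have [p +] := CX x; have [t _ ->] := circle_pt_surj p; exists t.
  by exists phi.
have [psi psiP] := choice CS.
pose x_ t := psi (circle_pt t).
have x_P t : C (x_ t) (circle_pt t) by exact: psiP.
have D0 : 0 < D.
  by have := distC _ _ _ _ (x_P 0) (x_P 0); rewrite !mdistxx subrr normr0.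
(* The slack that pays for the mesh [eta] and the step [eps / 2] on geodesics. *)
pose eps := pi / 2 - D; have eps0 : 0 < eps by rewrite subr_gt0.
have phi_dist x y : `|wrap (phi y - phi x)| < D + mdist x y.
  have := distC _ _ _ _ (phiP y) (phiP x); rewrite mdist_circle_pt metric_sym.
  by rewrite ltr_norml => /andP[? _]; lra.
have bndX (x y : X) : mdist x y <= D + pi.
  have := distC _ _ _ _ (phiP x) (phiP y); rewrite mdist_circle_pt.
  by have := normr_wrap (phi x - phi y); rewrite ltr_norml => ? /andP[? ?]; lra.
have jump (x y : X) : mdist x y < eps / 2 -> `|wrap (phi y - phi x)| < pi / 2.
  by have := phi_dist x y; rewrite /eps; lra.
have [|Phi PhiP] := angle_lift (x_ 0) _ bndX jump; first by rewrite divr_gt0.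
pose n := (Num.truncn (2 * pi / eps)).+1.
have n0 : 0 < n%:R :> R by rewrite ltr0n.
pose eta : R := 2 * pi / n%:R.
have eta0 : 0 < eta by rewrite divr_gt0// mulr_gt0.
have etaeps : eta < eps.
  by rewrite ltr_pdivrMr// [ltRHS]mulrC -ltr_pdivrMr//; exact: truncnS_gt.
pose a t := Phi (x_ t) - wrap (phi (x_ t) - t).
have arc t : mdist (circle_pt t) (circle_pt (t + eta)) <= eta.
  rewrite mdist_circle_pt (le_trans (normr_wrap_le 0 _))// mul0r addr0.
  by rewrite opprD addNKr normrN gtr0_norm.
have label x t : `|wrap (phi x - t)| < D + mdist x (x_ t).
  have := distC _ _ _ _ (phiP x) (x_P t); rewrite mdist_circle_pt.
  by rewrite ltr_norml => /andP[? _]; lra.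
have step t : a (t + eta) = a t + eta.
  pose y s := sigma (x_ t) (x_ (t + eta)) s.
  have i0 : 0 \in `[(0 : R), 1] by rewrite in_itv/= lexx ler01.
  have i1 : 1 \in `[(0 : R), 1] by rewrite in_itv/= lexx ler01.
  have y0 : y 0 = x_ t by exact: (ends _ _).1.
  have y1 : y 1 = x_ (t + eta) by exact: (ends _ _).2.
  pose L := mdist (x_ t) (x_ (t + eta)).
  have LD : L < D + eta.
    have := distC _ _ _ _ (x_P t) (x_P (t + eta)); have := arc t.
    by rewrite -/L ltr_norml => ? /andP[? ?]; lra.
  have L0 : 0 <= L by exact: mdist_ge0.
  (* The point is at distance at most half of [L < D + eta] from one of the ends. *)
  have labely s : s \in `[0, 1] -> `|wrap (phi (y s) - t)| < 3 / 2 * D + eta.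
    move=> s01; have h1 := label (y s) t.
    have h2 := distC _ _ _ _ (phiP (y s)) (x_P (t + eta)).
    have h3 := metric_triangle (circle_pt (phi (y s))) (circle_pt (t + eta)) (circle_pt t).
    have h4 := arc t.
    have d0 : mdist (y s) (x_ t) = s * L.
      by rewrite -y0 len//; move: s01; rewrite in_itv/= subr0 => /andP[? ?]; rewrite ger0_norm.
    have d1 : mdist (y s) (x_ (t + eta)) = (1 - s) * L.
      rewrite -y1 len// distrC; move: s01; rewrite in_itv/= => /andP[? ?].
      by rewrite ger0_norm ?subr_ge0.
    move: h2; rewrite ltr_norml => /andP[h2 _].
    move: h1 h2 h3 h4; rewrite d0 d1 (metric_sym (circle_pt (t + eta)) (circle_pt t)).
    rewrite [mdist (circle_pt (phi _)) (circle_pt t)]mdist_circle_pt.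
    by move=> h1 h2 h3 h4; lra.
  (* On the geodesic, all quantities [Phi (y s) - wrap (phi (y s) - t)] agree: two
     close labels, both within 3D/2 of [t], are not separated by its antipode. *)
  have const := @locally_constant (fun s => Phi (y s) - wrap (phi (y s) - t)).
  have {const} := const (eps / 2 / (L + 1)); rewrite y0 y1 => const.
  have L1 : 0 < L + 1 by rewrite ltr_wpDl.
  have {const} : a t = Phi (x_ (t + eta)) - wrap (phi (x_ (t + eta)) - t).
    apply: const => [|s s' s01 s'01 ss']; first by rewrite !divr_gt0.
    have ys : mdist (y s') (y s) < eps / 2.
      rewrite len// distrC -/L; move: ss'; rewrite ltr_pdivlMr//.
      by apply: le_lt_trans; rewrite ler_wpM2l// lerDl.
    have := PhiP _ _ ys; have := phi_dist (y s') (y s).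
    move: (labely _ s01) (labely _ s'01).
    have [k kE] := wrap_congr (phi (y s) - t).
    have [k' k'E] := wrap_congr (phi (y s') - t).
    rewrite !ltr_norml => /andP[? ?] /andP[? ?] /andP[? ?].
    rewrite -(@wrap_unique _ (k - k') (wrap (phi (y s) - t) - wrap (phi (y s') - t))).
    - by lra.
    - by rewrite kE k'E intrB; ring.
    - by rewrite ltr_norml; move: ys etaeps; rewrite /eps; lra.
  rewrite /a => ->.
  suff -> : wrap (phi (x_ (t + eta)) - t) = wrap (phi (x_ (t + eta)) - (t + eta)) + eta.
    by lra.
  have [k kE] := wrap_congr (phi (x_ (t + eta)) - (t + eta)).
  apply/esym/(@wrap_unique _ k); first by rewrite kE; ring.
  have := label (x_ (t + eta)) (t + eta); rewrite mdistxx.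
  have := labely 1 i1; rewrite y1 !ltr_norml => /andP[? ?] /andP[? ?].
  by move: etaeps; rewrite /eps; lra.
have winding j : a (j%:R * eta) = a 0 + j%:R * eta.
  elim: j => [|j ih]; first by rewrite mul0r addr0.
  by rewrite -natr1 mulrDl mul1r step ih addrA.
have := winding n; have -> : n%:R * eta = 2 * pi by rewrite mulrC divfK ?gt_eqF.
rewrite /a; have -> : x_ (2 * pi) = x_ 0.
  by rewrite /x_ -circle_ptB2pi subrr.
by rewrite wrapB2pi subr0; lra.
Qed.

Corollary gromov_hausdorff_circle_ge :
  ((pi / 4)%:E <= gromov_hausdorff_dist X (circle R))%E.
Proof.
rewrite leNgt; apply/negP => lt.
have [r rpi4 lt_r] : exists2 r : R, r < pi / 4 &
    (gromov_hausdorff_dist X (circle R) < r%:E)%E.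
  move: lt; case: (gromov_hausdorff_dist _ _) => [g| |]; rewrite ?lte_fin//.
    by move=> h; exists ((g + pi / 4) / 2); rewrite ?lte_fin; lra.
  by exists (pi / 4 - 1); [lra|exact: ltNyr].
have [C corrC distC] := gromov_hausdorff_lt_corr lt_r.
by have := correspondence_circle_distortion corrC distC; lra.
Qed.

End lower_bound.

(** * The triangle and its correspondence with the circle *)

Section triangle.
Variable R : realType.

Definition in_triangle (u : R * R) : bool := `|u.1| <= u.2 <= pi / 2.

Definition triangle : Type := {u : R * R | in_triangle u}.

HB.instance Definition _ :=
  Choice.copy triangle {u : R * R | in_triangle u}.

Implicit Types u v w : triangle.

Lemma triangleP u : `|(val u).1| <= (val u).2 <= pi / 2.
Proof. exact: (valP u). Qed.

Definition triangle_dist u v : R :=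
  Num.max `|(val u).1 - (val v).1| `|(val u).2 - (val v).2|.

Let triangle_distxx u : triangle_dist u u = 0.
Proof. by rewrite /triangle_dist !subrr normr0 maxxx. Qed.

Let triangle_dist_eq0 u v : triangle_dist u v = 0 -> u = v.
Proof.
move=> uv; apply: val_inj; have : triangle_dist u v <= 0 by rewrite uv.
rewrite ge_max !normr_le0 !subr_eq0; case: (val u) (val v) => [a b] [c d] /=.
by move=> /andP[/eqP -> /eqP ->].
Qed.

Let triangle_distC u v : triangle_dist u v = triangle_dist v u.
Proof. by rewrite /triangle_dist distrC [X in Num.max _ X]distrC. Qed.

Let triangle_dist_triangle v u w :
  triangle_dist u w <= triangle_dist u v + triangle_dist v w.
Proof.
rewrite ge_max; apply/andP; split.
  apply: le_trans (ler_distD (val v).1 _ _) _.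
  by apply: lerD; rewrite le_max lexx.
apply: le_trans (ler_distD (val v).2 _ _) _.
by apply: lerD; rewrite le_max lexx orbT.
Qed.

HB.instance Definition _ := @isMetric.Build R triangle triangle_dist
  triangle_distxx triangle_dist_eq0 triangle_distC triangle_dist_triangle.

(** The parameter is clamped to [0, 1] so that segments are defined on all of [R]
without leaving the triangle. *)
Lemma triangle_segment u v (t : R) : let s := Num.max 0 (Num.min 1 t) in
  in_triangle ((1 - s) * (val u).1 + s * (val v).1,
               (1 - s) * (val u).2 + s * (val v).2).
Proof.
rewrite /in_triangle/=; set s := Num.max _ _; have [s0 s1] : 0 <= s /\ s <= 1.
  by rewrite le_max lexx ge_max ler01 ge_min lexx.
have /andP[u1 u2] := triangleP u; have /andP[v1 v2] := triangleP v.
move: u1 v1; rewrite !ler_norml => /andP[? ?] /andP[? ?].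
rewrite -subr_ge0 in s1; apply/andP; split; [apply/andP; split|].
- by rewrite opprD -!mulrN lerD// ler_wpM2l.
- by rewrite lerD// ler_wpM2l.
- rewrite [leRHS](_ : _ = (1 - s) * (pi / 2) + s * (pi / 2)); last by ring.
  by rewrite lerD// ler_wpM2l.
Qed.

Definition segment u v t : triangle :=
  exist in_triangle _ (triangle_segment u v t).

Lemma segmentE u v t : t \in `[0, 1] -> val (segment u v t) =
  ((1 - t) * (val u).1 + t * (val v).1, (1 - t) * (val u).2 + t * (val v).2).
Proof.
by rewrite in_itv/= => /andP[t0 t1]; rewrite (min_idPr t1) (max_idPr t0).
Qed.

Lemma segment_bicombing : conical_bicombing segment.
Proof.
have i0 : 0 \in `[(0 : R), 1] by rewrite in_itv/= lexx ler01.
have i1 : 1 \in `[(0 : R), 1] by rewrite in_itv/= lexx ler01.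
split.
- move=> u v; split; apply: val_inj; rewrite segmentE//.
    by rewrite !subr0 !mul1r !mul0r !addr0; case: (val u).
  by rewrite !subrr !mul1r !mul0r !add0r; case: (val v).
- move=> u v s t s01 t01; rewrite /mdist/= /triangle_dist !segmentE//=.
  rewrite maxr_pMr//; congr Num.max.
    by rewrite -normrM -[LHS]normrN; congr `|_|; ring.
  by rewrite -normrM -[LHS]normrN; congr `|_|; ring.
- move=> u v w t t01; rewrite /mdist/= /triangle_dist !segmentE//=.
  have /andP[t0 t1] : 0 <= t <= 1 by rewrite in_itv/= in t01.
  have diff (a b c : R) :
      `|(1 - t) * a + t * b - ((1 - t) * a + t * c)| <= `|b - c|.
    by rewrite opprD addrACA subrr add0r -mulrBr normrM (ger0_norm t0) ler_piMl.
  by rewrite ge_max !le_max !diff orbT.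
Qed.

(** The angles matched with the point [(x, y)].  The first two clauses alone
miss the angles within pi/4 of 0 and of pi: the apex supplies the former, and the
ends of the top side the latter.  Angles are kept in [-5pi/4, 5pi/4], so that the
difference of two of them needs at most one turn to be wrapped. *)
Inductive angle_at (x y t : R) : Prop :=
| AngleLeft of x <= 0 & t = x - pi / 4
| AngleRight of 0 <= x & t = x + pi / 4
| AngleTopLeft of x <= - (pi / 4) & y = pi / 2 & t = 3 / 4 * pi - x
| AngleTopRight of pi / 4 <= x & y = pi / 2 & t = - (3 / 4 * pi) - x
| AngleApex of x = 0 & y = 0 & - (pi / 4) <= t <= pi / 4.

Definition triangle_angle u t : Prop := angle_at (val u).1 (val u).2 t.

Lemma wrap_angle_diff u v s t : triangle_angle u s -> triangle_angle v t ->
  [\/ wrap (s - t) = s - t, wrap (s - t) = s - t - 2 * pi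
     | wrap (s - t) = s - t + 2 * pi].
Proof.
suff bnd w r : triangle_angle w r -> `|r| <= 5 / 4 * pi.
  move=> /bnd + /bnd; rewrite !ler_norml => /andP[? ?] /andP[? ?].
  by apply: wrap_cases; rewrite ltr_norml; have := pi_gt0 R; lra.
have pi0 := pi_gt0 R; rewrite /triangle_angle; have := triangleP w.
case: (val w) => x y /= /andP[]; rewrite !ler_norml => /andP[? ?] ?.
by case=> [? ->|? ->|? ? ->|? ? ->|? ? /andP[? ?]]; lra.
Qed.

(** Only points on either side of the axis can be more than pi/2 apart.  By the
jump by pi/2 across the axis, their first angles differ by pi/2 more than their
abscissas do, which on the circle means by at least their distance minus pi/2
because abscissas differ by at most pi.  Two second angles give equality. *)
Lemma abscissa_diff_le u v s t : triangle_angle u s -> triangle_angle v t ->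
  (val u).1 - (val v).1 <= `|wrap (s - t)| + pi / 2.
Proof.
move=> us vt; have := wrap_angle_diff us vt; move: us vt.
have pi0 := pi_gt0 R; rewrite /triangle_angle; have := triangleP u; have := triangleP v.
have := ler_norm (wrap (s - t)); have := ler_norm (- wrap (s - t)); rewrite normrN.
case: (val u) (val v) => [x y] [x' y'] /=; rewrite !ler_norml.
move: (wrap _) (`|_|) => w W Ww WNw /andP[/andP[? ?] ?] /andP[/andP[? ?] ?].
move=> us vt wE; rewrite leNgt; apply/negP => far.
have x0 : 0 < x by lra.
have x'0 : x' < 0 by lra.
by case: us => [? ?|? ?|? _ ?|? _ ?|? _ _]; try lra;
  case: vt => [? ?|? ?|? _ ?|? _ ?|? _ _]; try lra; case: wE => wE; lra.
Qed.

(** First angles move as fast as abscissas, up to the jump by pi/2 across the axis.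
The apex, with angles within pi/4 of 0, is at distance at least |x| from a point
whose first angle is |x| + pi/4 in absolute value, and at distance pi/2 from any
point that has a second angle.  All pairs of clauses are treated alike: if
[t <= s] and the circle distance exceeds pi/2 + d, then [s - t] lies strictly
between pi/2 + d and 3pi/2 - d, which linear arithmetic excludes. *)
Lemma angle_diff_le u v s t : triangle_angle u s -> triangle_angle v t ->
  `|wrap (s - t)| <= pi / 2 + mdist u v.
Proof.
wlog ts : u v s t / t <= s => [wlog_ts us vt|us vt].
  have [|/ltW] := lerP t s => st; first exact: wlog_ts.
  rewrite -mdist_circle_pt metric_sym mdist_circle_pt metric_sym.
  exact: wlog_ts.
rewrite leNgt; apply/negP => far.
have := lt_le_trans far (normr_wrap_le 0 _).
have := lt_le_trans far (normr_wrap_le (-1) _).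
rewrite mul0r addr0 (@ger0_norm _ (s - t)) ?subr_ge0// intrN mulN1r ltr_normr.
move: us vt {far}; rewrite /triangle_angle; have := triangleP u; have := triangleP v.
have : `|(val u).1 - (val v).1| <= mdist u v by rewrite le_max lexx.
have : `|(val u).2 - (val v).2| <= mdist u v by rewrite le_max lexx orbT.
have pi0 := pi_gt0 R.
case: (val u) (val v) => [x y] [x' y'] /=; rewrite !ler_norml.
move: (mdist u v) => M.
move=> /andP[? ?] /andP[? ?] /andP[/andP[? ?] ?] /andP[/andP[? ?] ?] us vt.
case: us vt ts => [? ->|? ->|? ? ->|? ? ->|? ? /andP[? ?]]
  [? ->|? ->|? ? ->|? ? ->|? ? /andP[? ?]] => ? /orP[?|?] ?; lra.
Qed.

Lemma triangle_angle_distortion u v s t :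
  triangle_angle u s -> triangle_angle v t ->
  `|mdist u v - mdist (circle_pt s) (circle_pt t)| <= pi / 2.
Proof.
move=> us vt; have := angle_diff_le us vt.
rewrite -mdist_circle_pt => Wle; rewrite ler_norml; apply/andP; split; first by lra.
rewrite lerBlDl ge_max !ler_norml; apply/andP; split; apply/andP; split.
- rewrite lerNl opprB metric_sym mdist_circle_pt.
  exact: abscissa_diff_le.
- by rewrite mdist_circle_pt; exact: abscissa_diff_le.
all: have := mdist_ge0 (circle_pt s) (circle_pt t); have := triangleP u; have := triangleP v.
all: by case: (val u) (val v) => [x y] [x' y'] /=; rewrite !ler_norml; lra.
Qed.

Lemma in_triangle_apex : in_triangle (0, 0).
Proof. by rewrite /in_triangle/= normr0; have := pi_ge0 R; lra. Qed.

Lemma triangle_nonempty : [set: triangle] !=set0.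
Proof. by exists (exist in_triangle _ in_triangle_apex). Qed.

Lemma gromov_hausdorff_triangle_le :
  (gromov_hausdorff_dist triangle (circle R) <= (pi / 4)%:E)%E.
Proof.
have pi0 := pi_gt0 R.
pose C (u : triangle) (p : circle R) := exists2 t, triangle_angle u t & p = circle_pt t.
apply: (@gromov_hausdorff_le_corr _ _ _ C).
- by rewrite divr_gt0.
- split.
    move=> u; have [x0|x0] := lerP (val u).1 0.
      exists (circle_pt ((val u).1 - pi / 4)), ((val u).1 - pi / 4) => //.
      exact: AngleLeft.
    exists (circle_pt ((val u).1 + pi / 4)), ((val u).1 + pi / 4) => //.
    by apply: AngleRight => //; rewrite ltW.
  move=> p; have [t /andP[t0 t1] ->] := circle_pt_surj p.
  have sub (u : triangle) s : circle_pt s = circle_pt t -> triangle_angle u s ->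
      exists u, C u (circle_pt t) by move=> st us; exists u, s.
  have top x : - (pi / 2) <= x <= pi / 2 -> in_triangle (x, pi / 2).
    by move=> h; rewrite /in_triangle/= ler_norml h lexx.
  have [tm3|tm3] := lerP t (- (3 / 4 * pi)).
    have h : - (pi / 2) <= - (5 / 4 * pi) - t <= pi / 2 by lra.
    apply: (sub (exist in_triangle _ (top _ h)) (t + 2 * pi)).
      by rewrite -[LHS]circle_ptB2pi addrK.
    by apply: AngleTopLeft => //=; lra.
  have [tm1|tm1] := lerP t (- (pi / 4)).
    have h : - (pi / 2) <= t + pi / 4 <= pi / 2 by lra.
    apply: (sub (exist in_triangle _ (top _ h)) t) => //.
    by apply: AngleLeft => /=; lra.
  have [tp1|tp1] := lerP t (pi / 4).
    apply: (sub (exist in_triangle _ in_triangle_apex) t) => //.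
    by apply: AngleApex => //=; rewrite tp1 ltW.
  have [tp3|tp3] := lerP t (3 / 4 * pi).
    have h : - (pi / 2) <= t - pi / 4 <= pi / 2 by lra.
    apply: (sub (exist in_triangle _ (top _ h)) t) => //.
    by apply: AngleRight => /=; lra.
  have h : - (pi / 2) <= 5 / 4 * pi - t <= pi / 2 by lra.
  apply: (sub (exist in_triangle _ (top _ h)) (t - 2 * pi)).
    exact: circle_ptB2pi.
  by apply: AngleTopRight => //=; lra.
move=> u v p q [s us ->] [t vt ->].
by rewrite (le_trans (triangle_angle_distortion us vt))//; lra.
Qed.

End triangle.

Theorem theorem1p2 (R : realType) :
  exists E : metricType R,
    [/\ simply_connected E, geodesic_space E
      & gromov_hausdorff_dist E (circle R) = (pi / 4)%:E].
Proof.
have bicomb := @segment_bicombing R.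
exists (triangle R); split.
- exact: bicombing_simply_connected bicomb (triangle_nonempty R).
- exact: bicombing_geodesic bicomb.
- apply/eqP; rewrite eq_le gromov_hausdorff_triangle_le/=.
  exact: gromov_hausdorff_circle_ge bicomb.
Qed.
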